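(* Let $X$ be a Banach space and $G$ a compact topological group acting on $X$. Then $X$ is $G$-reflexive if, and only if, $B_X$ is compact in the topology $\sigma_G(X,X^* )$.
   Context: $X$ is a Banach space over $\mathbb{K}=\mathbb{R}$ or $\mathbb{C}$; $B_X$ is its closed unit ball. A compact topological group $G$ acting on $X$ means: a group $G\subseteq\mathcal{L}(X)$ of linear isometric isomorphisms of $X$ onto itself, compact for the relative topology inherited from $\mathcal{L}(X)$. $X_G=\{x\in X: g(x)=x\ \forall g\in G\}$; $X_G^*=\{f\in X^*: f(g(x))=f(x)\ \forall x\in X, g\in G\}$; $X^{**}_{G^{**}}=\{x^{**}\in X^{**}: g^{**}(x^{**})=x^{**}\ \forall g\in G\}$. $X$ is $G$-reflexive if $\pi(X_G)=X^{**}_{G^{**}}$, where $\pi:X\to X^{**}$ is the canonical injection. The weak group invariant topology $w_G=\sigma_G(X,X^* )$ is the topology on $X$ generated by the sets $\{x\in X: |\langle f_i,x-x_0\rangle|<\epsilon,\ 1\le i\le n\}$ with $x_0\in X$, $f_1,\dots,f_n\in X_G^*$, $\epsilon>0$. It need not be Hausdorff; compact means that every open cover has a finite subcover. *)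

(* Defs.v *)
From HB Require Import structures.
From mathcomp Require Import all_boot all_order all_algebra.
From mathcomp Require Import all_classical all_reals all_analysis.
From mathcomp Require Import complex.

Set Implicit Arguments.
Unset Strict Implicit.
Unset Printing Implicit Defensive.

Import Order.TTheory GRing.Theory Num.Theory.
Import numFieldNormedType.Exports.

Local Open Scope classical_set_scope.
Local Open Scope ring_scope.

Variant scalar_kind := RealScalars | ComplexScalars.

Definition scalars (R : realType) (k : scalar_kind) : numFieldType :=
  match k with
  | RealScalars => R
  | ComplexScalars => R[i]
  end.

(* Norms take their values in the scalar field, as real nonnegative elements;
   [to_real] and [of_real] move between those and [R], where suprema exist. *)
Definition to_real (R : realType) (k : scalar_kind) : scalars R k -> R :=
  match k with
  | RealScalars => fun x => x
  | ComplexScalars => fun z => complex.Re z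
  end.

Definition of_real (R : realType) (k : scalar_kind) : R -> scalars R k :=
  match k with
  | RealScalars => fun x => x
  | ComplexScalars => fun x => Complex x 0
  end.

Section real_scalars.
Context (R : realType) (k : scalar_kind).
Local Notation K := (scalars R k).

Lemma of_realK : cancel (@of_real R k) (@to_real R k).
Proof. by case: k. Qed.

Lemma to_realK (x : K) : 0 <= x -> of_real k (to_real x) = x.
Proof.
case: k x => //= x; rewrite lecE /= => /andP[/eqP].
by case: x => a b /= ->.
Qed.

Lemma le_of_real (x y : R) : (of_real k x <= of_real k y) = (x <= y).
Proof. by case: k => //=; rewrite lecE /= eqxx. Qed.

Lemma le_to_real (x y : K) : 0 <= x -> 0 <= y ->
  (to_real x <= to_real y) = (x <= y).
Proof. by move=> x0 y0; rewrite -le_of_real !to_realK. Qed.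

Lemma of_real0 : of_real k 0 = 0 :> K.
Proof. by case: k. Qed.

Lemma of_real_ge0 (x : R) : (0 <= of_real k x) = (0 <= x).
Proof. by rewrite -of_real0 le_of_real. Qed.

End real_scalars.

Section bounded_operators.
Context (R : realType) (k : scalar_kind).
Local Notation K := (scalars R k).
Context (X Y : normedModType K).

Definition continuous_linear_pred : {pred X -> Y} :=
  mem [set f : X -> Y | linear f /\ continuous f].

Lemma continuous_linear_submod : submod_closed continuous_linear_pred.
Proof.
split=> [|a f g]; rewrite ?inE.
  split; last exact: cst_continuous.
  by move=> a x y; rewrite -[RHS]/(a *: 0 + 0) scaler0 addr0.
move=> [fL fC] [gL gC]; split.
  move=> c x y; rewrite -[LHS]/(a *: f _ + g _) -[RHS]/(c *: (a *: f x + g x) + (a *: f y + g y)).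
  by rewrite fL gL !scalerDr !scalerA (mulrC c a) addrACA.
move=> x; apply: continuousD; last exact: gC.
by apply: continuousZr; exact: fC.
Qed.

HB.instance Definition _ := GRing.isSubmodClosed.Build K (X -> Y)
  continuous_linear_pred continuous_linear_submod.

Record bounded_op := BoundedOp {
  bounded_op_fun :> X -> Y;
  bounded_op_subproof : bounded_op_fun \in continuous_linear_pred }.

HB.instance Definition _ := [isSub for bounded_op_fun].
HB.instance Definition _ := [Choice of bounded_op by <:].
HB.instance Definition _ := [SubChoice_isSubLmodule of bounded_op by <:].

Definition mk_bounded_op (f : X -> Y) (fL : linear f) (fC : continuous f) :=
  @BoundedOp f (mem_set (conj fL fC)).

Lemma bounded_op_linear (T : bounded_op) : linear T.
Proof. by case: T => f /= /set_mem[]. Qed.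

Lemma bounded_op_continuous (T : bounded_op) : continuous T.
Proof. by case: T => f /= /set_mem[]. Qed.

HB.instance Definition _ (T : bounded_op) :=
  GRing.isLinear.Build K X Y *:%R (bounded_op_fun T) (bounded_op_linear T).

Lemma bounded_opP (S T : bounded_op) : S =1 T -> S = T.
Proof. by move=> ST; apply: val_inj; apply/funext. Qed.

Definition opnorm (T : bounded_op) : K :=
  of_real k (sup [set to_real `|T x| | x in [set x : X | `|x| <= 1]]).

Let unit_values (T : bounded_op) :=
  [set to_real `|T x| | x in [set x : X | `|x| <= 1]].

Lemma has_sup_opnorm (T : bounded_op) : has_sup (unit_values T).
Proof.
split; first by exists (to_real `|T 0|); exists 0 => //=; rewrite normr0.
have [_ /(_ (@bounded_op_continuous T))] := linear_bounded_continuous T.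
move=> /linear_boundedP/pinfty_ex_gt0[r r0 Tr].
exists (to_real r) => _ [x /= x1 <-]; rewrite le_to_real ?normr_ge0 ?(ltW r0)//.
by apply: le_trans (Tr x) _; rewrite ler_piMr// ltW.
Qed.

Lemma opnorm_ge0 (T : bounded_op) : 0 <= opnorm T.
Proof.
rewrite of_real_ge0; apply: (sup_upper_bound (has_sup_opnorm T)).
exists 0; rewrite /= ?normr0//.
by rewrite linear0 normr0 -(of_real0 R k) of_realK.
Qed.

Lemma le_opnorm (T : bounded_op) (x : X) : `|T x| <= opnorm T * `|x|.
Proof.
have [->|x0] := eqVneq x 0; first by rewrite linear0 !normr0 mulr0.
rewrite -ler_pdivrMr ?normr_gt0// mulrC.
have -> : `|x|^-1 * `|T x| = `|T (`|x|^-1 *: x)|.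
  by rewrite linearZ normrZ normfV normr_id.
rewrite -[leLHS](to_realK (normr_ge0 _)) le_of_real.
apply: (sup_upper_bound (has_sup_opnorm T)); exists (`|x|^-1 *: x) => //=.
by rewrite normfZV.
Qed.

Lemma opnorm_le (T : bounded_op) (c : K) : 0 <= c ->
  (forall x, `|T x| <= c * `|x|) -> opnorm T <= c.
Proof.
move=> c0 Tc; rewrite -[leRHS]to_realK// le_of_real.
apply: ge_sup; first by case: (has_sup_opnorm T).
move=> _ [x /= x1 <-]; rewrite le_to_real//.
by rewrite (le_trans (Tc x))// ler_piMr.
Qed.

Lemma ler_opnormD (S T : bounded_op) : opnorm (S + T) <= opnorm S + opnorm T.
Proof.
apply: opnorm_le => [|x]; first by rewrite addr_ge0// opnorm_ge0.
by rewrite mulrDl (le_trans (ler_normD _ _))// lerD// le_opnorm.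
Qed.

Lemma opnormZ (a : K) (T : bounded_op) : opnorm (a *: T) = `|a| * opnorm T.
Proof.
have H (b : K) (S : bounded_op) : opnorm (b *: S) <= `|b| * opnorm S.
  apply: opnorm_le => [|x]; first by rewrite mulr_ge0// opnorm_ge0.
  by rewrite -[X in `|X|]/(b *: S x) normrZ -mulrA ler_wpM2l// le_opnorm.
apply/eqP; rewrite eq_le H /=; have [->|a0] := eqVneq a 0.
  by rewrite normr0 mul0r opnorm_ge0.
rewrite -ler_pdivlMl ?normr_gt0// -normfV.
by rewrite -{1}(scalerK a0 T) H.
Qed.

Lemma opnorm0_eq0 (T : bounded_op) : opnorm T = 0 -> T = 0.
Proof.
move=> T0; apply: bounded_opP => x; apply/eqP; rewrite -[X in _ == X]/(0 : Y).
by rewrite -normr_le0 (le_trans (le_opnorm T x))// T0 mul0r.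
Qed.

HB.instance Definition _ := Lmodule_isNormed.Build K bounded_op
  ler_opnormD opnormZ opnorm0_eq0.

End bounded_operators.

Section operations.
Context (R : realType) (k : scalar_kind).
Local Notation K := (scalars R k).

Lemma bounded_op_id_linear (X : normedModType K) : linear (@idfun X).
Proof. by []. Qed.

Lemma bounded_op_id_continuous (X : normedModType K) : continuous (@idfun X).
Proof. by move=> x. Qed.

Definition bounded_op_id (X : normedModType K) : bounded_op X X :=
  mk_bounded_op (@bounded_op_id_linear X) (@bounded_op_id_continuous X).

Context (X Y Z : normedModType K).

Lemma bounded_op_comp_linear (S : bounded_op Y Z) (T : bounded_op X Y) :
  linear (S \o T).
Proof. by move=> a x y /=; rewrite !linearP. Qed.

Lemma bounded_op_comp_continuous (S : bounded_op Y Z) (T : bounded_op X Y) :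
  continuous (S \o T).
Proof.
by move=> x; apply: continuous_comp; exact: bounded_op_continuous.
Qed.

Definition bounded_op_comp (S : bounded_op Y Z) (T : bounded_op X Y) :
    bounded_op X Z :=
  mk_bounded_op (bounded_op_comp_linear S T)
    (@bounded_op_comp_continuous S T).

End operations.

Section duality.
Context (R : realType) (k : scalar_kind).
Local Notation K := (scalars R k).

Definition dual (X : normedModType K) := bounded_op X K^o.

HB.instance Definition _ (X : normedModType K) := NormedModule.on (dual X).

Context (X Y : normedModType K).

Lemma bounded_linear_continuous_le (V W : normedModType K) (f : V -> W)
  (c : K) : linear f -> (forall v, `|f v| <= c * `|v|) -> continuous f.
Proof.
move=> fL fc.
pose fLi := GRing.isLinear.Build K V W *:%R f fL.
pose g : {linear V -> W} := HB.pack f fLi.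
apply: (@bounded_linear_continuous _ _ _ g); apply/ex_bound.
exists `|c|; apply/nbhs_norm0P; exists 1 => //= x /= x1.
apply: (le_trans (fc x)).
have cx0 : 0 <= c * `|x| := le_trans (normr_ge0 _) (fc x).
by rewrite -(ger0_norm cx0) normrM normr_id ler_piMr// ltW.
Qed.

Section adjoint.
Variable T : bounded_op X Y.

Let adj (f : dual Y) : dual X := bounded_op_comp f T.

Lemma adjoint_linear : linear adj.
Proof. by move=> a f g; apply: bounded_opP. Qed.

Lemma adjoint_continuous : continuous adj.
Proof.
apply: (bounded_linear_continuous_le (c := opnorm T) adjoint_linear) => f.
apply: opnorm_le => [|x]; first by rewrite mulr_ge0 ?opnorm_ge0.
apply: (le_trans (le_opnorm f (T x))).
rewrite -[`|f|]/(opnorm f) (mulrC (opnorm T)) -mulrA.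
by rewrite ler_wpM2l ?opnorm_ge0// le_opnorm.
Qed.

Definition adjoint : bounded_op (dual Y) (dual X) :=
  mk_bounded_op adjoint_linear (@adjoint_continuous).

End adjoint.

Definition bidual := dual (dual X).

Section evaluation.
Variable x : X.

Let ev (f : dual X) : K^o := f x.

Lemma canonical_injection_linear : linear ev.
Proof. by []. Qed.

Lemma canonical_injection_continuous : continuous ev.
Proof.
apply: (bounded_linear_continuous_le (c := `|x|) canonical_injection_linear).
by move=> f; rewrite mulrC; exact: le_opnorm.
Qed.

Definition canonical_injection : bidual :=
  mk_bounded_op canonical_injection_linear
    (@canonical_injection_continuous).

End evaluation.

End duality.

(* A copy of X, indexed by G, carrying the topology sigma_G(X, X^* ) instead of
   the norm topology. *)
Definition weak_G_space (R : realType) (k : scalar_kind)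
  (X : normedModType (scalars R k)) (G : set (bounded_op X X)) : Type := X.

Section group_action.
Context (R : realType) (k : scalar_kind).
Local Notation K := (scalars R k).
Context (X : normedModType K).

Record compact_group_acting (G : set (bounded_op X X)) : Prop := {
  acting_isometry : forall g, G g -> forall x, `|g x| = `|x| ;
  acting_onto : forall g, G g -> set_surj setT setT g ;
  acting_id : G (bounded_op_id X) ;
  acting_comp : forall g h, G g -> G h -> G (bounded_op_comp g h) ;
  acting_inv : forall g, G g -> exists2 h, G h &
    bounded_op_comp g h = bounded_op_id X /\
    bounded_op_comp h g = bounded_op_id X ;
  acting_compact : compact G }.

Variable G : set (bounded_op X X).

Definition invariant_vectors : set X :=
  [set x | forall g, G g -> g x = x].

Definition invariant_functionals : set (dual X) :=
  [set f | forall x g, G g -> f (g x) = f x].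

Definition invariant_bidual : set (bidual X) :=
  [set F | forall g, G g -> adjoint (adjoint g) F = F].

Definition G_reflexive : Prop :=
  @canonical_injection R k X @` invariant_vectors = invariant_bidual.

Definition closed_unit_ball : set X := [set x | `|x| <= 1].

(* [0 < e] in the scalar field forces [e] to be real, also over C. *)
Definition weak_G_subbase : set (set (weak_G_space G)) :=
  [set U | exists (x0 : X) (n : nat) (f : 'I_n -> dual X) (e : K),
    [/\ forall i, invariant_functionals (f i), 0 < e &
        U = [set x : X | forall i, `|f i (x - x0)| < e]]].

HB.instance Definition _ := Choice.on (weak_G_space G).
HB.instance Definition _ := isPointed.Build (weak_G_space G) (0 : X).
HB.instance Definition _ := isSubBaseTopological.Build (weak_G_space G)
  weak_G_subbase (fun U : set (weak_G_space G) => U).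

End group_action.

Arguments closed_unit_ball {R k} X.

(* Main.v *)
(* Averaging over [G] gives a contractive projection [P] of [X] onto [X_G], which
   turns the statement into "[X_G] is reflexive iff its ball is weakly compact".
   No Haar measure is needed: if [a_1, ..., a_n] is a fine net of [G], replacing
   [A] by the mean of the [a_i A a_j] decreases the diameter of [G A G] by a
   definite amount, so finite means of [G] become almost invariant, and they
   converge in norm to [P].
   If [X] is [G]-reflexive, the limit [F] along an ultrafilter on the ball gives
   an invariant [F o P^*], represented by a point of the ball (Hahn-Banach) to
   which the ultrafilter converges. Conversely, if the ball is compact, an
   invariant [F] of norm at most 1 is approximated by points of the ball on
   finitely many functionals (Helly), and a cluster point [p] of these
   approximations gives [F = pi (P p)]. *)

Require Import Defs.
From HB Require Import structures.
From mathcomp Require Import all_boot all_order all_algebra.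
From mathcomp Require Import all_classical all_reals all_analysis.
From mathcomp Require Import complex perm.
From mathcomp Require Import ring lra.

Set Implicit Arguments.
Unset Strict Implicit.
Unset Printing Implicit Defensive.

Import Order.TTheory GRing.Theory Num.Theory.
Import numFieldNormedType.Exports.

Local Open Scope classical_set_scope.
Local Open Scope ring_scope.

(** * The scalar field *)

(** Conjugation over both fields at once: the real part of [scalar_conj w * z] is the real inner
    product of [w] and [z]. *)
Definition scalar_conj (R : realType) (k : scalar_kind) :
    scalars R k -> scalars R k :=
  match k with
  | RealScalars => fun x => x
  | ComplexScalars => fun z => (z^*)%C
  end.

Section real_part.
Context (R : realType) (k : scalar_kind).
Local Notation K := (scalars R k).

Lemma of_realD (x y : R) : of_real k (x + y) = of_real k x + of_real k y.
Proof. by case: k => //=; apply/eqP; rewrite eq_complex /= addr0 !eqxx. Qed.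

Lemma of_realM (x y : R) : of_real k (x * y) = of_real k x * of_real k y.
Proof.
by case: k => //=; apply/eqP; rewrite eq_complex /= !mulr0 !mul0r subr0 addr0 !eqxx.
Qed.

Lemma of_real1 : of_real k (1 : R) = 1.
Proof. by case: k. Qed.

Lemma to_realD (x y : K) : to_real (x + y) = to_real x + to_real y.
Proof. by case: k x y => // [[a b] [c d]]. Qed.

Lemma to_realN (x : K) : to_real (- x) = - to_real x.
Proof. by case: k x => // [[a b]]. Qed.

Lemma to_real_of_realM (t : R) (z : K) :
  to_real (of_real k t * z) = t * to_real z.
Proof. by case: k z => //= [[a b]] /=; rewrite mul0r subr0. Qed.

Lemma to_real_le_norm (z : K) : to_real z <= to_real `|z|.
Proof.
case: k z => //= [z|[a b] /=]; first exact: ler_norm.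
rewrite (le_trans (ler_norm a))// -sqrtr_sqr ler_wsqrtr// lerDl sqr_ge0//.
Qed.

Lemma to_real_norm_ge0 (V : normedModType K) (v : V) : 0 <= to_real `|v|.
Proof. by rewrite -(of_real_ge0 k) to_realK. Qed.

Lemma to_real_normD (V : normedModType K) (v w : V) :
  to_real `|v + w| <= to_real `|v| + to_real `|w|.
Proof. by rewrite -to_realD le_to_real ?addr_ge0// ler_normD. Qed.

Lemma to_real_normZ (V : normedModType K) (t : R) (v : V) : 0 <= t ->
  to_real `|of_real k t *: v| = t * to_real `|v|.
Proof.
by move=> t0; rewrite normrZ ger0_norm ?of_real_ge0// to_real_of_realM.
Qed.

Lemma to_real_conjM (z : K) :
  to_real (scalar_conj z * z) = to_real `|z| ^+ 2.
Proof.
case: k z => //= [z|[a b] /=]; first by rewrite real_normK ?num_real ?expr2.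
by rewrite sqr_sqrtr ?addr_ge0 ?sqr_ge0//; ring.
Qed.

Lemma sqr_normB (t : R) (w z : K) :
  to_real `|w - of_real k t * z| ^+ 2 =
  to_real `|w| ^+ 2 - 2 * t * to_real (scalar_conj w * z)
    + t ^+ 2 * to_real `|z| ^+ 2.
Proof.
case: k w z => //= [w z|[a b] [c d] /=].
  by rewrite !real_normK ?num_real//; ring.
by rewrite !sqr_sqrtr ?addr_ge0 ?sqr_ge0//; ring.
Qed.

(** A positive scalar is real, so the Archimedean property of [R] transfers to [K]. *)
Lemma scalar_archimedean (e : K) : 0 < e -> exists n, n.+1%:R^-1 < e.
Proof.
move=> e0; have re0 : 0 < to_real e.
  rewrite lt_neqAle -(of_real_ge0 k) to_realK ?(ltW e0)// andbT eq_sym.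
  apply/eqP => er; have := e0; rewrite -(to_realK (ltW e0)) er of_real0.
  by rewrite ltxx.
have [n _ /(_ n (leqnn n)) /= ne] := near_infty_natSinv_lt (PosNum re0).
exists n; have nr m : of_real k (m%:R : R) = m%:R :> K.
  by elim: m => [|m IHm]; rewrite ?of_real0//  !mulrS of_realD of_real1 IHm.
have -> : n.+1%:R^-1 = of_real k (n.+1%:R^-1 : R) :> K.
  apply: (mulfI (_ : (n.+1%:R : K) != 0)); first by rewrite pnatr_eq0.
  by rewrite divff ?pnatr_eq0// -nr -of_realM divff ?pnatr_eq0// of_real1.
rewrite lt_neqAle -[X in _ <= X](to_realK (ltW e0)) le_of_real (ltW ne) andbT.
by apply/eqP => ee; rewrite -ee of_realK ltxx in ne.
Qed.

(** Stands in for a passage to the limit in [K]: if x > 0, then n = 0 forces c > 0, and some 1/(n+1)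
    is below x/c. *)
Lemma le_all_invn (x c : K) : 0 <= x ->
  (forall n, x <= c * n.+1%:R^-1) -> x = 0.
Proof.
move=> x0 xc; have [//|xn0] := eqVneq x 0.
have xp : 0 < x by rewrite lt_def xn0.
have c0 : 0 < c by have := xc 0; rewrite invr1 mulr1; apply: lt_le_trans.
have [n] := scalar_archimedean (divr_gt0 xp c0).
by rewrite ltr_pdivlMr// mulrC => /(le_lt_trans (xc n)); rewrite ltxx.
Qed.

Lemma le_add_invn (x y c : K) : 0 <= x -> 0 <= y ->
  (forall n, x <= y + c * n.+1%:R^-1) -> x <= y.
Proof.
move=> x0 y0 xy; have [//|yx] := real_leP (ger0_real x0) (ger0_real y0).
suff /eqP : x - y = 0 by rewrite subr_eq0 => /eqP eq_xy; rewrite eq_xy ltxx in yx.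
apply: (@le_all_invn _ c); first by rewrite subr_ge0 ltW.
by move=> n; rewrite lerBlDl.
Qed.

Lemma lt_to_real (x y : K) : 0 <= x -> 0 <= y ->
  (to_real x < to_real y) = (x < y).
Proof.
move=> x0 y0; rewrite !lt_neqAle le_to_real//; congr (~~ _ && _).
by apply/eqP/eqP => [xy|->//]; rewrite -(to_realK x0) xy to_realK.
Qed.

End real_part.

(** * Hahn-Banach *)

Section hahn_banach.
Context (R : realType) (k : scalar_kind) (X : lmodType (scalars R k)).
Implicit Types (p q : X -> R) (x y : X).

(** [of_real] turns a complex space into a real one. An inequality for t > 0 suffices: applying it
    to the inverse of t gives equality. *)
Definition sublinear q :=
  (forall x y, q (x + y) <= q x + q y) /\
  (forall t x, 0 < t -> q (of_real k t *: x) <= t * q x).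

Lemma of_real_scaleA (s t : R) x :
  of_real k s *: (of_real k t *: x) = of_real k (s * t) *: x.
Proof. by rewrite scalerA of_realM. Qed.

Lemma sublinear0 q : sublinear q -> q 0 = 0.
Proof.
move=> [_ qZ]; have := qZ 2 0; have := qZ 2^-1 0.
by rewrite !scaler0 => /(_ _)h1 /(_ _)h2; lra.
Qed.

Lemma sublinearZ q t x : sublinear q -> 0 <= t ->
  q (of_real k t *: x) = t * q x.
Proof.
move=> qS; rewrite le_eqVlt => /predU1P[<-|t0].
  by rewrite of_real0 scale0r mul0r sublinear0.
apply/eqP; rewrite eq_le qS.2//= -ler_pdivlMl//.
rewrite -{1}[x]scale1r -(of_real1 R k) -(mulVf (lt0r_neq0 t0)) -of_real_scaleA.
by apply: qS.2; rewrite invr_gt0.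
Qed.

Lemma sublinearN q x : sublinear q -> - q (- x) <= q x.
Proof. by move=> qS; have := qS.1 x (- x); rewrite subrr sublinear0//; lra. Qed.

(** The members [b i] need not be sublinear one by one; it is enough that the family absorbs sums
    and dilations. It serves both the shifts of a functional and the chains in Zorn's lemma. *)
Lemma sublinear_inf (I : Type) (P : set I) (b : I -> X -> R) :
  P !=set0 -> (forall x, has_lbound [set b i x | i in P]) ->
  (forall i j x y, P i -> P j ->
    exists2 l, P l & b l (x + y) <= b i x + b j y) ->
  (forall i t x, P i -> 0 < t ->
    exists2 l, P l & b l (of_real k t *: x) <= t * b i x) ->
  sublinear (fun x => inf [set b i x | i in P]).
Proof.
move=> [i0 Pi0] lb bD bZ.
have ne x : [set b i x | i in P] !=set0 by exists (b i0 x), i0.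
split=> [x y|t x t0].
  rewrite -lerBlDr; apply: lb_le_inf => // _ [i Pi <-].
  rewrite lerBlDr -lerBlDl; apply: lb_le_inf => // _ [j Pj <-].
  rewrite lerBlDl; have [l Pl /(le_trans _)->//] := bD i j x y Pi Pj.
  by apply: ge_inf => //; exists l.
rewrite -ler_pdivrMl//; apply: lb_le_inf => // _ [i Pi <-].
rewrite ler_pdivrMl//; have [l Pl /(le_trans _)->//] := bZ i t x Pi t0.
by apply: ge_inf => //; exists l.
Qed.

(** Take the infimum over t >= 0 of q(x + t y) - t q(y). It is bounded below by -q(-x); t = 0 gives
    r <= q, and t = 1 at x = -y gives the last bound. *)
Lemma sublinear_shift q y : sublinear q -> exists r,
  [/\ sublinear r, forall x, r x <= q x & r (- y) <= - q y].
Proof.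
move=> qS; pose b t x := q (x + of_real k t *: y) - t * q y.
pose P := [set t : R | 0 <= t].
have lb x : has_lbound [set b t x | t in P].
  exists (- q (- x)) => _ [t t0 <-]; rewrite /b -(sublinearZ _ qS)//.
  have := qS.1 (x + of_real k t *: y) (- x); rewrite addrAC subrr add0r; lra.
exists (fun x => inf [set b t x | t in P]); split.
- apply: sublinear_inf => //; first by exists 0; rewrite /P/=.
    move=> s t x z; rewrite /P /= => s0 t0; exists (s + t); first exact: addr_ge0.
    rewrite /b of_realD scalerDl addrACA.
    have := qS.1 (x + of_real k s *: y) (z + of_real k t *: y); lra.
  move=> s t x; rewrite /P /= => s0 t0; exists (t * s).
    by rewrite /= mulr_ge0// ltW.
  by rewrite /b -of_real_scaleA -scalerDr (sublinearZ _ qS (ltW t0)) mulrBr mulrA.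
- move=> x; apply: ge_inf => //; exists 0; first by rewrite /P/=.
  by rewrite /b of_real0 scale0r addr0 mul0r subr0.
- apply: ge_inf => //; exists 1; first by rewrite /P/=.
  by rewrite /b of_real1 scale1r addNr sublinear0// mul1r add0r.
Qed.

(* A minimal sublinear functional coincides with all its shifts, which makes
   it odd, hence additive. *)
Lemma sublinear_minimal_linear q : sublinear q ->
  (forall r, sublinear r -> (forall x, r x <= q x) -> r = q) ->
  (forall x y, q (x + y) = q x + q y) /\
  (forall t x, q (of_real k t *: x) = t * q x).
Proof.
move=> qS qmin; have qN x : q (- x) = - q x.
  have [r [rS rq ry]] := sublinear_shift x qS.
  rewrite (qmin r)// in ry; apply/eqP; rewrite eq_le ry/=.
  by rewrite lerNl sublinearN.
split=> [x y|t x].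
  apply/eqP; rewrite eq_le qS.1/=.
  by have := qS.1 (x + y) (- y); rewrite addrK qN; lra.
have [t0|t0] := leP 0 t; first exact: sublinearZ.
rewrite -[t]opprK -[of_real k _](_ : - of_real k (- t) = _); last first.
  apply/eqP; rewrite eq_sym -addr_eq0 -of_realD; apply/eqP.
  by rewrite opprK addrN of_real0.
by rewrite scaleNr qN sublinearZ// ?mulNr// oppr_ge0 ltW.
Qed.

(** Zorn's lemma for the reversed pointwise order. A nonempty chain has its pointwise infimum as
    bound, finite since every member stays above -p(-x); the empty chain is bounded by [p]. *)
Lemma sublinear_minimal p : sublinear p -> exists q,
  [/\ sublinear q, forall x, q x <= p x &
    forall r, sublinear r -> (forall x, r x <= q x) -> r = q].
Proof.
move=> pS; pose T := {q : X -> R | sublinear q /\ forall x, q x <= p x}.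
pose le (q r : T) := `[< forall x, sval r x <= sval q x >].
have [||||q qmin] := @Zorn T le.
- by move=> q; apply/asboolP.
- move=> q r s /asboolP h1 /asboolP h2; apply/asboolP => x.
  exact: le_trans (h2 x) (h1 x).
- move=> [q hq] [r hr] /asboolP/= h1 /asboolP/= h2; have qr : q = r.
    by apply/funext => x; apply/eqP; rewrite eq_le h1 h2.
  by case: _ / qr in hr h1 h2 *; rewrite (Prop_irrelevance hq hr).
- move=> A Atot; have [[q0 Aq0]|A0] := pselect (A !=set0); last first.
    by exists (exist _ p (conj pS (fun x => lexx _))) => s As; case: A0; exists s.
  pose m x := inf [set sval q x | q in A].
  have lb x : has_lbound [set sval q x | q in A].
    exists (- p (- x)) => _ [[q [qS qp]] Aq <-] /=.
    by rewrite (le_trans _ (sublinearN x qS))// lerN2.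
  have mS : sublinear m.
    apply: sublinear_inf => //; first by exists q0.
      move=> i j x y Ai Aj; have [qS _] := svalP i; have [rS _] := svalP j.
      have [/asboolP ij|/asboolP ij] := Atot _ _ Ai Aj.
        by exists j => //; apply: (le_trans (rS.1 x y)); rewrite lerD2r.
      by exists i => //; apply: (le_trans (qS.1 x y)); rewrite lerD2l.
    move=> i t x Ai t0; exists i => //.
    by have [qS _] := svalP i; exact: qS.2.
  have mp x : m x <= p x.
    apply: (@le_trans _ _ (sval q0 x)); last by have [_] := svalP q0.
    by apply: ge_inf => //; exists q0.
  exists (exist _ m (conj mS mp)) => s As; apply/asboolP => x /=.
  by apply: ge_inf => //; exists s.
have [qS qp] := svalP q; exists (sval q); split=> // r rS rq.
have rp x : r x <= p x by exact: le_trans (rq x) (qp x).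
by rewrite -(qmin (exist _ r (conj rS rp)))//; apply/asboolP.
Qed.

(** A minimal [u] below the shift of [p] along [y] is linear, and u(-y) <= -p(y) then reads u(y) >=
    p(y). *)
Lemma hahn_banach p y : sublinear p -> exists u : X -> R,
  [/\ forall x z, u (x + z) = u x + u z,
      forall t x, u (of_real k t *: x) = t * u x,
      forall x, u x <= p x & u y = p y].
Proof.
move=> pS; have [r [rS rp ry]] := sublinear_shift y pS.
have [u [uS ur umin]] := sublinear_minimal rS.
have [uD uZ] := sublinear_minimal_linear uS umin; exists u; split=> //.
  by move=> x; exact: le_trans (ur x) (rp x).
apply/eqP; rewrite eq_le (le_trans (ur y))//=.
have := uD y (- y); rewrite subrr sublinear0// => uyN.
by have := le_trans (ur (- y)) ry; lra.
Qed.

End hahn_banach.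

(** Hahn-Banach for the norm gives a real-linear [u] with u(x0) = |x0|. Prescribing only the real
    part of f(x0) is enough to bound |x0| by |f(x0)|. *)
Lemma norming_functional (R : realType) (k : scalar_kind)
    (X : normedModType (scalars R k)) (x0 : X) :
  exists f : dual X, (forall x, `|f x| <= `|x|) /\
    to_real (f x0) = to_real `|x0|.
Proof.
have pS : sublinear (fun x : X => to_real `|x|).
  split; first exact: to_real_normD.
  by move=> t x t0; rewrite to_real_normZ// ltW.
have [u [uD uZ up ux0]] := hahn_banach x0 pS.
suff [f fL [f1 fx0]] : exists2 f : X -> (scalars R k)^o, linear f &
    (forall x, `|f x| <= `|x|) /\ to_real (f x0) = u x0.
  have fC : continuous f.
    by apply: (bounded_linear_continuous_le (c := 1) fL) => x; rewrite mul1r.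
  by exists (mk_bounded_op fL fC); split; rewrite //= fx0 ux0.
have uN x : u (- x) = - u x.
  apply/eqP; rewrite -addr_eq0 -uD addNr; apply/eqP.
  by have := uZ 0 x; rewrite of_real0 scale0r mul0r.
have uabs x : `|u x| <= to_real `|x|.
  by rewrite ler_norml up andbT lerNl -uN -normrN up.
case: k X x0 u uD uZ uN up uabs {pS ux0} => /= X x0 u uD uZ uN up uabs.
  by exists u => // a x y; rewrite uD uZ.
have u0 : u 0 = 0 by have := uN 0; rewrite oppr0; lra.
(* The complex-linear functional whose real part is [u]. *)
pose f (x : X) : R[i]^o := (u x +i* - u ('i%C *: x))%C.
have fL : linear f.
  move=> [a b] x y; rewrite /f.
  have E z : ((a +i* b)%C : R[i]) *: z = Complex a 0 *: z + Complex b 0 *: ('i%C *: z).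
    rewrite scalerA -scalerDl; congr (_ *: z); apply/eqP.
    by rewrite eq_complex /=; apply/andP; split; apply/eqP; ring.
  have ii z : ('i%C : R[i]) *: ('i%C *: z) = - z.
    by rewrite scalerA -expr2 sqr_i scaleN1r.
  have uZ' := uZ : forall t x, u (Complex t 0 *: x) = t * u x.
  have comm z (t : R) :
      ('i%C : R[i]) *: (Complex t 0 *: z) = Complex t 0 *: ('i%C *: z).
    by rewrite !scalerA mulrC.
  rewrite scalerDr E scalerDr !comm ii !uD !uZ' uN.
  apply/eqP; rewrite eq_complex /=; apply/andP; split; apply/eqP; ring.
exists f => //; split=> // x.
have [fx0|fx0] := eqVneq (f x) 0; first by rewrite fx0 normr0.
(* A unimodular factor making f(a x) real and nonnegative, hence equal to u(a x), which is at most
   |x|. *)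
pose a : R[i] := `|f x| / f x.
have afx : f (a *: x) = `|f x|.
  have -> : f (a *: x) = a * f x.
    by have := fL a x 0; rewrite addr0 => ->; rewrite /f scaler0 u0 oppr0 addr0.
  by rewrite /a divfK.
have a1 : `|a| = 1 by rewrite normrM normfV normr_id divff// normr_eq0.
rewrite -(@le_to_real R ComplexScalars)//.
have -> : `|x| = `|a *: x| by rewrite normrZ a1 mul1r.
apply: le_trans (up _); rewrite -afx.
by rewrite /f /=.
Qed.

(** * Limits of bounded scalar functions along an ultrafilter *)

(** The image ultrafilter contains the compact interval [-M, M], so it has a cluster point, and an
    ultrafilter converges to its cluster points. *)
Lemma real_ultra_lim (R : realType) (T : Type) (U : set_system T)
    (phi : T -> R) (M : R) : UltraFilter U -> U [set x | `|phi x| <= M] ->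
  exists l, forall e : R, 0 < e -> U [set x | `|l - phi x| < e].
Proof.
move=> UU UM.
have UI : U [set x | phi x \in `[- M, M]].
  by apply: filterS UM => x /=; rewrite in_itv/= ler_norml.
have [l [_ Ul]] := @segment_compact R (- M) M (phi @ U) _ UI.
exists l => e e0; have [//|UC] := in_ultra_setVsetC [set x | `|l - phi x| < e] UU.
have [||y [/= h]] := Ul [set y | ~ (`|l - y| < e)] (ball l e).
- exact: UC.
- exact: nbhsx_ballx.
- by [].
Qed.

Lemma ultra_lim (R : realType) (k : scalar_kind) (T : Type) (U : set_system T)
    (phi : T -> scalars R k) (M : R) : UltraFilter U ->
    U [set x | to_real `|phi x| <= M] ->
  exists l, forall e, 0 < e -> U [set x | `|l - phi x| < e].
Proof.
case: k phi => phi UU UM; first exact: real_ultra_lim UM.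
have Re_le (z : R[i]) : `|complex.Re z| <= @to_real R ComplexScalars `|z|.
  case: z => a b /=; rewrite -[leLHS]sqrtr_sqr ler_wsqrtr//.
  by rewrite lerDl sqr_ge0.
have Im_le (z : R[i]) : `|complex.Im z| <= @to_real R ComplexScalars `|z|.
  case: z => a b /=; rewrite -[leLHS]sqrtr_sqr ler_wsqrtr//.
  by rewrite lerDr sqr_ge0.
have [|a aU] := @real_ultra_lim R T U (fun x => complex.Re (phi x)) M UU.
  by apply: filterS UM => x /=; apply: le_trans.
have [|b bU] := @real_ultra_lim R T U (fun x => complex.Im (phi x)) M UU.
  by apply: filterS UM => x /=; apply: le_trans.
exists (a +i* b)%C => e e0.
have [er e0'] : e = (complex.Re e)%:C%C /\ 0 < complex.Re e.
  by case: (e) e0 => c d; rewrite ltcE /= => /andP[/eqP-> ->].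
have e2 : 0 < complex.Re e / 2 by rewrite divr_gt0.
apply: filterS2 (aU _ e2) (bU _ e2) => x /= h1 h2.
rewrite normc_def er ltcR.
apply: (@le_lt_trans _ _ (`|a - complex.Re (phi x)| + `|b - complex.Im (phi x)|)).
  rewrite -[leRHS]ger0_norm ?addr_ge0// -sqrtr_sqr ler_wsqrtr//.
  rewrite sqrrD !real_normK ?num_real//.
  case: (phi x) => c d /=; rewrite lerD2r lerDl.
  by rewrite mulrn_wge0// mulr_ge0.
lra.
Qed.

(** * Helly's theorem *)

Lemma to_real_sum (R : realType) (k : scalar_kind) (I : Type) (r : seq I)
    (P : pred I) (c : I -> scalars R k) :
  to_real (\sum_(i <- r | P i) c i) = \sum_(i <- r | P i) to_real (c i).
Proof. by apply: big_morph; [exact: to_realD | case: (k)]. Qed.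

Lemma bounded_op_sumE (R : realType) (k : scalar_kind)
    (X Y : normedModType (scalars R k)) (I : Type) (r : seq I) (P : pred I)
    (T : I -> bounded_op X Y) x :
  (\sum_(i <- r | P i) T i) x = \sum_(i <- r | P i) T i x.
Proof. exact: (big_morph (fun S : bounded_op X Y => S x)). Qed.

Section helly.
Context (R : realType) (k : scalar_kind) (X : normedModType (scalars R k)).
Local Notation K := (scalars R k).

(** Bounding real parts on the ball suffices, since a unimodular multiple of x makes f(x) equal to
    its modulus. *)
Lemma dual_norm_le (f : dual X) (c : R) :
  (forall x, `|x| <= 1 -> to_real (f x) <= c) -> to_real `|f| <= c.
Proof.
move=> fc; rewrite -[`|f|]/(opnorm f) /opnorm of_realK.
apply: ge_sup; first by case: (has_sup_opnorm f).
move=> _ [x /= x1 <-]; have [fx0|fx0] := eqVneq (f x) 0.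
  by rewrite fx0 normr0 -(linear0 f) fc// normr0.
pose a : K := `|f x| / f x.
have afx : f (a *: x) = `|f x| by rewrite linearZ /a; exact: divfK.
rewrite -afx fc// normrZ normrM normfV normr_id divff ?mul1r//.
by rewrite normr_eq0.
Qed.

(* The points of the ball nearly minimizing the distance to the values of [F]
   satisfy a first order condition; it would make the combination [phi] of the
   functionals, weighted by the conjugates of the errors, violate
   [|F phi| <= |phi|] if the distance were positive. *)
Lemma helly (F : bidual X) (s : seq (dual X)) (e : R) :
    (forall f, `|F f| <= `|f|) -> 0 < e ->
  exists2 x, `|x| <= 1 & \sum_(f <- s) to_real `|F f - f x| ^+ 2 < e.
Proof.
move=> F1 e0; apply: contrapT => noX.
pose J x := \sum_(f <- s) to_real `|F f - f x| ^+ 2.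
pose B := [set x : X | `|x| <= 1].
have Je x : B x -> e <= J x.
  by move=> Bx; rewrite leNgt; apply/negP => Jx; apply: noX; exists x.
have hJ : has_inf [set J x | x in B].
  split; first by exists (J 0), 0; rewrite // /B /= normr0.
  by exists e => _ [x Bx <-]; exact: Je.
pose d := inf [set J x | x in B].
have d0 : 0 < d.
  apply: lt_le_trans e0 _; apply: lb_le_inf; first by case: hJ.
  by move=> _ [x Bx <-]; exact: Je.
have dJ x : B x -> d <= J x.
  by move=> Bx; apply: ge_inf; [case: hJ | exists x].
(* Bounds the sum of |f(x - x0)|^2 over [s], as points of the ball are at distance at most 2. *)
pose C := \sum_(f <- s) 4 * to_real `|f| ^+ 2.
have C0 : 0 <= C by apply: sumr_ge0 => f _; rewrite mulr_ge0// sqr_ge0.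
(* A step length with t <= 1, so that moving from x0 towards x stays in the ball, and with t C <=
   d/2, so that the quadratic term is controlled. *)
pose t := d / (d + 2 * C).
have dC0 : 0 < d + 2 * C by lra.
have t0 : 0 < t by rewrite divr_gt0.
have t1 : t <= 1 by rewrite ler_pdivrMr// mul1r; lra.
have tC : t * C <= d / 2.
  rewrite /t mulrAC ler_pdivrMr// [leRHS](_ : _ = d * C + d ^+ 2 / 2); last by field.
  by rewrite lerDl divr_ge0// sqr_ge0.
have td0 : 0 < t * d / 2 by rewrite divr_gt0// mulr_gt0.
have [_ [x0 Bx0 <-] Jx0] := inf_adherent td0 hJ.
rewrite -/d in Jx0.
pose w (f : dual X) : K := F f - f x0.
pose phi : dual X := \sum_(f <- s) scalar_conj (w f) *: f.
have phiE x : to_real (phi x) = \sum_(f <- s) to_real (scalar_conj (w f) * f x).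
  by rewrite bounded_op_sumE to_real_sum.
have FphiE : to_real (F phi) = \sum_(f <- s) to_real (scalar_conj (w f) * F f).
  rewrite /phi linear_sum to_real_sum; apply: eq_bigr => f _.
  by rewrite linearZ.
have FJ : to_real (F phi) = to_real (phi x0) + J x0.
  rewrite FphiE phiE -big_split; apply: eq_bigr => f _ /=.
  by rewrite -to_real_conjM -to_realD -mulrDr addrC subrK.
(* First order condition: d <= J(y) <= J(x0) - 2 t D + t^2 C, where D is the real part of phi(x -
   x0). Since J(x0) < d + t d/2 and t C <= d/2, this gives D <= d/2. *)
have step x : B x -> to_real (phi x) <= to_real (phi x0) + d / 2.
  move=> Bx; pose y := x0 + of_real k t *: (x - x0).
  have By : B y.
    rewrite /B /= -[y]/(x0 + of_real k t *: (x - x0)).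
    have -> : x0 + of_real k t *: (x - x0) =
        of_real k (1 - t) *: x0 + of_real k t *: x.
      rewrite scalerBr addrCA addrC; congr (_ + _).
      rewrite -{1}[x0]scale1r -scalerBl; congr (_ *: _); apply/eqP.
      by rewrite subr_eq -of_realD subrK of_real1.
    apply: le_trans (ler_normD _ _) _; rewrite !normrZ.
    rewrite !ger0_norm ?of_real_ge0 ?subr_ge0 ?(ltW t0)//.
    have -> : 1 = of_real k (1 - t) + of_real k t by rewrite -of_realD subrK of_real1.
    rewrite lerD// ler_piMr//.
      by rewrite of_real_ge0 subr_ge0.
    by rewrite of_real_ge0 ltW.
  have Jy : J y <= J x0 - 2 * t * (to_real (phi x) - to_real (phi x0)) + t ^+ 2 * C.
    rewrite !phiE -sumrB 2!mulr_sumr -sumrB -big_split /=.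
    apply: ler_sum => f _.
    have -> : F f - f y = w f - of_real k t * (f x - f x0).
      by rewrite /y linearD linearZ linearB /w opprD addrA.
    rewrite sqr_normB mulrBr to_realD to_realN lerD2l ler_wpM2l ?sqr_ge0//.
    have -> : 4 * to_real `|f| ^+ 2 = (2 * to_real `|f|) ^+ 2 by ring.
    rewrite lerXn2r ?nnegrE ?to_real_norm_ge0 ?mulr_ge0 ?to_real_norm_ge0//.
    have fB z : B z -> to_real `|f z| <= to_real `|f|.
      move=> Bz; rewrite le_to_real//.
      by rewrite (le_trans (le_opnorm f z))// ler_piMr// opnorm_ge0.
    have := to_real_normD (f x : K^o) (- f x0 : K^o); rewrite normrN.
    by have := fB _ Bx; have := fB _ Bx0; lra.
  have := le_trans (dJ _ By) Jy.
  set D := to_real (phi x) - _ => h.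
  suff : D <= d / 2 by rewrite /D; lra.
  rewrite -(ler_pM2l t0); have : t * (t * C) <= t * (d / 2) by rewrite ler_pM2l.
  by rewrite mulrA -expr2 => h'; lra.
(* As J(x0) >= d, this makes |phi| smaller than |F phi| by at least d/2, against |F phi| <=
   |phi|. *)
have phi_le : to_real `|phi| <= to_real (F phi) - d / 2.
  by apply: dual_norm_le => x /step; have := dJ _ Bx0; rewrite FJ; lra.
have := to_real_le_norm (F phi).
have : to_real `|F phi| <= to_real `|phi| by rewrite le_to_real.
by lra.
Qed.

End helly.

(** * Averaging over a compact group *)

Section means.
Context (R : realType) (k : scalar_kind) (V : normedModType (scalars R k)).
Local Notation K := (scalars R k).

Lemma mean_cst (I : finType) (v : V) : (0 < #|I|)%N ->
  #|I|%:R^-1 *: (\sum_(i : I) v) = v.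
Proof.
move=> I0; rewrite sumr_const -[v *+ _]scaler_nat scalerA mulVf ?scale1r//.
by rewrite pnatr_eq0 -lt0n.
Qed.

Lemma norm_mean_le (I : finType) (a : I -> V) (c : K) : (0 < #|I|)%N ->
  (forall i, `|a i| <= c) -> `|#|I|%:R^-1 *: \sum_i a i| <= c.
Proof.
move=> I0 ac; rewrite normrZ normfV normr_nat ler_pdivrMl ?ltr0n//.
apply: le_trans (ler_norm_sum _ _ _) _.
by rewrite mulr_natl -sumr_const; apply: ler_sum.
Qed.

Lemma dist_mean_le (I : finType) (a : I -> V) (v : V) (c : K) : (0 < #|I|)%N ->
  (forall i, `|a i - v| <= c) -> `|#|I|%:R^-1 *: \sum_i a i - v| <= c.
Proof.
move=> I0 ac; rewrite -{1}(mean_cst v I0) -scalerBr -sumrB.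
exact: norm_mean_le.
Qed.

(* Pairing off the two close terms leaves [#|I| - 1] differences of size at
   most [d]. *)
Lemma dist_means_le (I : finType) (u v : I -> V) (p q : I) (c d : K) :
  `|u p - v q| <= c -> (forall i j, `|u i - v j| <= d) ->
  `|#|I|%:R^-1 *: \sum_i u i - #|I|%:R^-1 *: \sum_i v i|
    <= d - #|I|%:R^-1 * (d - c).
Proof.
move=> upq uv; have I0 : (0 < #|I|)%N by apply/card_gt0P; exists p.
(* The transposition of p and q matches [u p] with [v q]. *)
rewrite [X in _ - _ *: X](reindex_perm (tperm p q)) -scalerBr -sumrB.
rewrite normrZ normfV normr_nat ler_pdivrMl ?ltr0n// mulrBr mulrA.
rewrite mulfV ?pnatr_eq0 -?lt0n// mul1r.
apply: le_trans (ler_norm_sum _ _ _) _.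
rewrite (bigD1 p)//= tpermL.
have -> : #|I|%:R * d - (d - c) = c + \sum_(i | i != p) d.
  rewrite mulr_natl -[in LHS]sumr_const (bigD1 p)//=; ring.
by apply: lerD => //; apply: ler_sum => i _.
Qed.

End means.

Section composition.
Context (R : realType) (k : scalar_kind).
Local Notation K := (scalars R k).
Context (X Y Z : normedModType K).

Lemma bounded_op_comp_norm (S : bounded_op Y Z) (T : bounded_op X Y) :
  `|bounded_op_comp S T| <= `|S| * `|T|.
Proof.
apply: opnorm_le => [|x]; first by rewrite mulr_ge0.
apply: le_trans (le_opnorm S (T x)) _.
by rewrite -mulrA ler_wpM2l ?opnorm_ge0// le_opnorm.
Qed.

Lemma bounded_op_compBr (S : bounded_op Y Z) (T U : bounded_op X Y) :
  bounded_op_comp S (T - U) = bounded_op_comp S T - bounded_op_comp S U.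
Proof. by apply: bounded_opP => x; exact: linearB. Qed.

Lemma bounded_op_compBl (S T : bounded_op Y Z) (U : bounded_op X Y) :
  bounded_op_comp (S - T) U = bounded_op_comp S U - bounded_op_comp T U.
Proof. exact: bounded_opP. Qed.

Lemma bounded_op_comp_meanr (S : bounded_op Y Z) (c : K) (I : finType)
    (T : I -> bounded_op X Y) :
  bounded_op_comp S (c *: \sum_i T i) = c *: \sum_i bounded_op_comp S (T i).
Proof.
apply: bounded_opP => x; rewrite [RHS]/(c *: _) /=.
rewrite -[LHS]/(S (c *: (\sum_i T i) x)) linearZ !bounded_op_sumE linear_sum.
by [].
Qed.

Lemma bounded_op_comp_meanl (c : K) (I : finType)
    (S : I -> bounded_op Y Z) (T : bounded_op X Y) :
  bounded_op_comp (c *: \sum_i S i) T = c *: \sum_i bounded_op_comp (S i) T.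
Proof.
apply: bounded_opP => x.
rewrite -[LHS]/(c *: (\sum_i S i) (T x)).
rewrite -[RHS]/(c *: (\sum_i bounded_op_comp (S i) T) x).
by rewrite !bounded_op_sumE.
Qed.

End composition.

(** * Finite means of the group with small two-sided oscillation *)

Section oscillation.
Context (R : realType) (k : scalar_kind) (X : normedModType (scalars R k)).
Local Notation K := (scalars R k).
Local Notation op := (bounded_op X X).
Local Notation "S ** T" := (bounded_op_comp S T) (at level 39, left associativity).
Context (G : set op).
Context (hG : compact_group_acting G).

(** Iterated uniform means: averaging a mean again stays in the class, and properties stable under
    averages follow by induction. *)
Inductive group_mean : op -> Prop :=
| group_mean_base g : G g -> group_mean g
| group_mean_avg (I : finType) (a : I -> op) : (0 < #|I|)%N ->
    (forall i, group_mean (a i)) -> group_mean (#|I|%:R^-1 *: \sum_i a i).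

Lemma group_norm_le1 g : G g -> `|g| <= 1.
Proof.
move=> Gg; apply: opnorm_le => // x; rewrite mul1r.
by rewrite (acting_isometry hG).
Qed.

Lemma group_mean_norm_le1 A : group_mean A -> `|A| <= 1.
Proof. by elim=> [g /group_norm_le1//|I a I0 _ a1]; exact: norm_mean_le. Qed.

Lemma group_mean_comp A g h : group_mean A -> G g -> G h ->
  group_mean (g ** A ** h).
Proof.
move=> mA Gg Gh; elim: mA => [a Ga|I a I0 _ IH].
  by apply/group_mean_base/(acting_comp hG) => //; exact: (acting_comp hG).
by rewrite bounded_op_comp_meanr bounded_op_comp_meanl; exact: group_mean_avg.
Qed.

(** Total boundedness of the compact set [G] in the operator norm. *)
Lemma group_net (e : K) : 0 < e -> exists2 s : seq op,
  (forall a, a \in s -> G a) & forall g, G g -> exists2 a, a \in s & `|g - a| <= e.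
Proof.
move=> e0; have := acting_compact hG; rewrite compact_cover => cG.
have [|g Gg|D DG Dcover] := cG op G (fun g => ball g e).
- by move=> g _; exact: ball_open.
- by exists g => //; exact: ballxx.
exists (finmap.enum_fset D) => [a aD|g Gg]; first by have := DG _ aD; rewrite inE.
have [a aD] := Dcover _ Gg; rewrite -ball_normE /= => ag.
by exists a => //; rewrite distrC ltW.
Qed.

(** The diameter of G A G is at most [d]. Being two-sided, it controls both g A - A and A g - A. *)
Definition oscillation_le (A : op) (d : K) := forall g h g' h',
  G g -> G h -> G g' -> G h' -> `|g ** A ** h - g' ** A ** h'| <= d.

Lemma bounded_op_compA (S T U : op) : S ** T ** U = S ** (T ** U).
Proof. exact: bounded_opP. Qed.

Lemma bounded_op_id_comp (S : op) : bounded_op_id X ** S = S.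
Proof. exact: bounded_opP. Qed.

Lemma bounded_op_comp_id (S : op) : S ** bounded_op_id X = S.
Proof. exact: bounded_opP. Qed.

(* If [a] and [b] are close to the inverses of [g] and [h], then the term
   [g a A b h] of the mean is close to [A], whatever [g] and [h]. *)
Lemma oscillation_step (e : K) : 0 < e -> exists2 N : nat, (0 < N)%N &
  forall A d, group_mean A -> oscillation_le A d ->
  exists2 B, group_mean B & oscillation_le B (d - N%:R^-1 * (d - 4 * e)).
Proof.
move=> e0; have [s sG net] := group_net e0.
pose I := (seq_sub s * seq_sub s)%type : finType.
have net' g : G g -> exists i : seq_sub s, `|g - ssval i| <= e.
  by move=> /net[a sa ga]; exists (SeqSub sa).
have Gs (i : seq_sub s) : G (ssval i) by apply: sG; exact: ssvalP.
have [i0 _] := net' _ (acting_id hG).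
(* The number of pairs from the net depends on [e] alone, so the same gain is available for every
   [A]. *)
exists #|{: I}|; first by apply/card_gt0P; exists (i0, i0).
move=> A d mA Ad; exists (#|{: I}|%:R^-1 *:
    \sum_(i : I) (ssval i.1 ** A ** ssval i.2)).
  apply: group_mean_avg; first by apply/card_gt0P; exists (i0, i0).
  by move=> i; exact: group_mean_comp.
have close g h : G g -> G h -> exists i : I,
    `|g ** (ssval i.1 ** A ** ssval i.2) ** h - A| <= 2 * e.
  move=> Gg Gh; have [g' Gg' [gg' _]] := acting_inv hG Gg.
  have [h' Gh' [_ hh']] := acting_inv hG Gh.
  have [i gi] := net' _ Gg'; have [j hj] := net' _ Gh'.
  exists (i, j) => /=.
  have gi1 : `|g ** ssval i - bounded_op_id X| <= e.
    rewrite -gg' -bounded_op_compBr; apply: le_trans (bounded_op_comp_norm _ _) _.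
    by rewrite distrC in gi; apply: le_trans gi; rewrite ler_piMl// group_norm_le1.
  have hj1 : `|ssval j ** h - bounded_op_id X| <= e.
    rewrite -hh' -bounded_op_compBl; apply: le_trans (bounded_op_comp_norm _ _) _.
    by rewrite distrC in hj; apply: le_trans hj; rewrite ler_piMr// group_norm_le1.
  have -> : g ** (ssval i ** A ** ssval j) ** h - A =
      (g ** ssval i - bounded_op_id X) ** (A ** (ssval j ** h)) +
      A ** (ssval j ** h - bounded_op_id X).
    rewrite bounded_op_compBl bounded_op_compBr bounded_op_id_comp.
    by rewrite bounded_op_comp_id !bounded_op_compA addrA subrK.
  rewrite [leRHS](_ : _ = e + e); last by ring.
  apply: le_trans (ler_normD _ _) _; apply: lerD.
    apply: le_trans (bounded_op_comp_norm _ _) _.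
    apply: le_trans gi1; rewrite ler_piMr//.
    apply: le_trans (bounded_op_comp_norm _ _) _.
    apply: mulr_ile1 => //; first exact: group_mean_norm_le1.
    by apply: group_norm_le1; exact: (acting_comp hG).
  apply: le_trans (bounded_op_comp_norm _ _) _.
  by apply: le_trans hj1; rewrite ler_piMl// group_mean_norm_le1.
move=> g h g' h' Gg Gh Gg' Gh'.
rewrite !bounded_op_comp_meanr !bounded_op_comp_meanl.
have [p gp] := close g h Gg Gh; have [q gq] := close g' h' Gg' Gh'.
(* One term of each mean is within 2e of [A], so these two are within 4e of each other; all other
   differences are at most d because the net lies in [G]. *)
apply: (@dist_means_le _ _ _ _ _ _ p q).
  apply: le_trans (ler_distD A _ _) _.
  rewrite [leRHS](_ : _ = 2 * e + 2 * e); last by ring.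
  by apply: lerD; [exact: gp | rewrite distrC; exact: gq].
move=> i j; have comp := acting_comp hG.
have E a b (l : I) : a ** (ssval l.1 ** A ** ssval l.2) ** b =
    (a ** ssval l.1) ** A ** (ssval l.2 ** b).
  exact: bounded_opP.
by rewrite !E; apply: Ad; apply: comp => //; exact: Gs.
Qed.

(** Otherwise the averaging step could be repeated forever, each time lowering the bound by the
    fixed amount [c], until it became negative. *)
Lemma small_oscillation (e : K) : 0 < e ->
  exists2 A, group_mean A & oscillation_le A e.
Proof.
(* With e/8 the gain is (d - e/2)/N, which exceeds e/(2N) as long as d > e. *)
move=> e0; have [|N N0 step] := @oscillation_step (e / 8) _.
  by rewrite divr_gt0.
apply: contrapT => noA; pose c := N%:R^-1 * (e / 2).
have c0 : 0 < c by rewrite mulr_gt0 ?invr_gt0 ?ltr0n// divr_gt0.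
have osc m : exists2 A, group_mean A & oscillation_le A (2 - m%:R * c).
  elim: m => [|m [A mA Am]].
    have G1 := acting_id hG.
    exists (bounded_op_id X); first exact: group_mean_base.
    move=> g h g' h' Gg Gh Gg' Gh'; rewrite mul0r subr0.
    rewrite !bounded_op_comp_id; apply: le_trans (ler_normB _ _) _.
    by rewrite -[leRHS]/(1 + 1) lerD// group_norm_le1//; exact: (acting_comp hG).
  have [B mB Bm] := step _ _ mA Am; exists B => // g h g' h' Gg Gh Gg' Gh'.
  apply: le_trans (Bm _ _ _ _ Gg Gh Gg' Gh') _.
  set d := 2 - m%:R * c in Am *.
  (* As a bound of a norm, [d] is a real scalar, hence comparable with [e] also over C. *)
  have d0 : 0 <= d.
    have G1 := acting_id hG.
    by apply: le_trans (Am _ _ _ _ G1 G1 G1 G1).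
  have [de|ed] := real_leP (ger0_real d0) (gtr0_real e0).
    exfalso; apply: noA; exists A => // x y x' y' Gx Gy Gx' Gy'.
    exact: le_trans (Am _ _ _ _ Gx Gy Gx' Gy') de.
  have -> : 2 - m.+1%:R * c = d - c by rewrite /d mulrS; ring.
  rewrite lerD2l lerN2 ler_pM2l ?invr_gt0 ?ltr0n//.
  have -> : 4 * (e / 8) = e / 2 by field.
  rewrite lerBrDr [leLHS](_ : _ = e); last by field.
  exact: ltW.
have [m mc] := scalar_archimedean (divr_gt0 c0 (ltr0Sn _ 1)).
have [A _ Am] := osc m.+1; have G1 := acting_id hG.
have := le_trans (normr_ge0 _) (Am _ _ _ _ G1 G1 G1 G1).
move: mc; rewrite ltr_pdivlMr ?ltr0n// ltr_pdivrMl ?ltr0n// => mc.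
by rewrite subr_ge0 => /(lt_le_trans mc); rewrite ltxx.
Qed.

End oscillation.

(** * The averaging projection and its adjoints *)

Section projection.
Context (R : realType) (k : scalar_kind) (X : completeNormedModType (scalars R k)).
Local Notation K := (scalars R k).
Local Notation op := (bounded_op X X).
Local Notation "S ** T" := (bounded_op_comp S T) (at level 39, left associativity).
Context (G : set op).
Context (hG : compact_group_acting G).

Lemma group_mean_dist_left (A T : op) (c : K) : group_mean G A ->
  (forall g, G g -> `|g ** T - T| <= c) -> `|A ** T - T| <= c.
Proof.
move=> mA gT; elim: mA => [|I a I0 _ IH]; first exact: gT.
by rewrite bounded_op_comp_meanl; exact: dist_mean_le.
Qed.

Lemma group_mean_dist_right (A T : op) (c : K) : group_mean G A ->
  (forall g, G g -> `|T ** g - T| <= c) -> `|T ** A - T| <= c.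
Proof.
move=> mA gT; elim: mA => [|I a I0 _ IH]; first exact: gT.
by rewrite bounded_op_comp_meanr; exact: dist_mean_le.
Qed.

Lemma adjoint_mean (c : K) (I : finType) (a : I -> op) (f : dual X) :
  adjoint (c *: \sum_i a i) f = c *: \sum_i adjoint (a i) f.
Proof. exact: bounded_op_comp_meanr. Qed.

Lemma group_mean_invariant_functional (A : op) (f : dual X) : group_mean G A ->
  invariant_functionals G f -> adjoint A f = f.
Proof.
move=> mA fG; elim: mA => [g Gg|I a I0 _ IH].
  by apply: bounded_opP => x; exact: fG.
rewrite adjoint_mean -[RHS](mean_cst f I0).
by congr (_ *: _); apply: eq_bigr => i _.
Qed.

Lemma group_mean_invariant_bidual (A : op) (F : bidual X) (f : dual X) :
  group_mean G A -> invariant_bidual G F -> F (adjoint A f) = F f.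
Proof.
move=> mA FG; elim: mA => [g Gg|I a I0 _ IH].
  by rewrite -[in RHS](FG g Gg).
rewrite adjoint_mean linearZ linear_sum.
rewrite (eq_bigr (fun _ => F f)) => [|i _]; last exact: IH.
exact: mean_cst.
Qed.

(** Putting the identity in three of the four places of the oscillation bound gives almost
    invariance on either side. *)
Lemma almost_invariant_means : exists B : nat -> op,
  [/\ forall n, group_mean G (B n),
      forall n g, G g -> `|g ** B n - B n| <= n.+1%:R^-1 &
      forall n g, G g -> `|B n ** g - B n| <= n.+1%:R^-1].
Proof.
have G1 := acting_id hG.
have e0 n : 0 < n.+1%:R^-1 :> K by rewrite invr_gt0 ltr0n.
have /choice[B hB] n : exists A, group_mean G A /\ oscillation_le G A n.+1%:R^-1.
  by have [A mA Ao] := small_oscillation hG (e0 n); exists A.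
exists B; split=> n; first by case: (hB n).
  move=> g Gg; have [_ /(_ g _ _ _ Gg G1 G1 G1)] := hB n.
  by rewrite !bounded_op_comp_id bounded_op_id_comp.
move=> g Gg; have [_ /(_ _ g _ _ G1 Gg G1 G1)] := hB n.
by rewrite !bounded_op_id_comp bounded_op_comp_id.
Qed.

(* [P] is the Haar mean of the group, obtained as a norm limit of finite
   means. *)
Lemma averaging_projection : exists P : op,
  [/\ forall x, `|P x| <= `|x|,
      forall x, invariant_vectors G (P x),
      forall f : dual X, invariant_functionals G (adjoint P f),
      forall f : dual X, invariant_functionals G f -> adjoint P f = f &
      forall (F : bidual X) f, invariant_bidual G F ->
        F (adjoint P f) = F f].
Proof.
have [B [mB Bl Br]] := almost_invariant_means.
pose u n : K := n.+1%:R^-1.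
have u0 n : 0 < u n by rewrite invr_gt0 ltr0n.
have uP m n : (n <= m)%N -> u m <= u n.
  by move=> nm; rewrite lef_pV2 ?posrE ?ltr0n// ler_nat.
(* The product of [B m] and [B n] is close to [B n] by left almost invariance of [B n], and close to
   [B m] by right almost invariance of [B m]. *)
have Bdist m n x : (n <= m)%N -> `|B m x - B n x| <= 2 * u n * `|x|.
  move=> nm; apply: le_trans (le_opnorm (B m - B n) x) _.
  apply: ler_wpM2r => //; rewrite -[opnorm _]/(`|B m - B n|).
  have -> : B m - B n = (B m ** B n - B n) - (B m ** B n - B m).
    by rewrite opprB [RHS]addrC addrA subrK.
  have -> : 2 * u n = u n + u n by ring.
  apply: le_trans (ler_normB _ _) _; apply: lerD.
    by apply: group_mean_dist_left => //; exact: Bl.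
  apply: le_trans (uP _ _ nm).
  by apply: group_mean_dist_right => //; exact: Br.
(* The limit is taken pointwise, by completeness of [X]. The constant 3 is 2 from the Cauchy
   estimate plus 1 for a late index approximating the limit. *)
have /choice[P PB] x : exists y : X, forall n, `|y - B n x| <= 3 * u n * `|x|.
  have [->|x0] := eqVneq x 0.
    by exists 0 => n; rewrite linear0 subrr normr0 mulr0.
  have nx0 : 0 < `|x| by rewrite normr_gt0.
  have cB : cvg ((fun n => B n x) @ \oo).
    apply/cauchy_cvgP; apply: cauchy_exP => e e0.
    have [n ne] := scalar_archimedean (divr_gt0 e0 (mulr_gt0 (ltr0Sn K 1) nx0)).
    exists (B n x); exists n => // m /= nm.
    rewrite -ball_normE /= distrC; apply: le_lt_trans (Bdist _ _ _ nm) _.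
    by move: ne; rewrite ltr_pdivlMr ?mulr_gt0// mulrCA mulrA.
  exists (lim ((fun n => B n x) @ \oo)) => n.
  have [N _ hN] := proj1 (cvgrPdist_lt _ _) cB _ (mulr_gt0 (u0 n) nx0).
  have := hN (maxn N n) (leq_maxl _ _); set l := lim _ => /= hl.
  have -> : 3 * u n * `|x| = u n * `|x| + 2 * u n * `|x| by ring.
  rewrite -(subrK (B (maxn N n) x) l) -addrA.
  apply: le_trans (ler_normD _ _) _; apply: lerD; first exact: ltW.
  by apply: Bdist; exact: leq_maxr.
have eqP_lim (V : normedModType K) (v w : V) (c : K) :
    (forall n, `|v - w| <= c * u n) -> v = w.
  by move=> vw; apply/eqP; rewrite -subr_eq0 -normr_eq0; apply/eqP/(le_all_invn _ vw).
have PL : linear P.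
  move=> a x y.
  apply: (eqP_lim _ _ _ (3 * `|a *: x + y| + `|a| * (3 * `|x|) + 3 * `|y|)).
  move=> n.
  have -> : P (a *: x + y) - (a *: P x + P y) =
      (P (a *: x + y) - B n (a *: x + y)) -
      (a *: (P x - B n x) + (P y - B n y)).
    by rewrite scalerBr addrACA -opprD -[X in _ - (_ - X)]linearP opprB addrA subrK.
  apply: le_trans (ler_normB _ _) _; rewrite -addrA mulrDl; apply: lerD.
    by rewrite mulrAC.
  apply: le_trans (ler_normD _ _) _; rewrite mulrDl; apply: lerD.
    by rewrite normrZ -mulrA ler_wpM2l// mulrAC.
  by rewrite mulrAC.
have Pn x : `|P x| <= `|x|.
  have Bn n : `|B n x| <= `|x|.
    apply: le_trans (le_opnorm (B n) x) _.
    by rewrite ler_piMl// (group_mean_norm_le1 hG).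
  apply: (@le_add_invn _ _ _ _ (3 * `|x|)) => // n.
  rewrite mulrAC -(subrK (B n x) (P x)) addrC.
  by apply: le_trans (ler_normD _ _) _; rewrite lerD.
have PC : continuous P.
  by apply: (bounded_linear_continuous_le (c := 1) PL) => x; rewrite mul1r.
pose Q : op := mk_bounded_op PL PC.
(* The rate is uniform on the ball, so the convergence holds in operator norm. *)
have QB n : `|Q - B n| <= 3 * u n.
  apply: opnorm_le => [|x]; last exact: PB.
  by rewrite mulr_ge0// ltW.
(* Replacing [Q] by [B n] costs 3/(n+1) twice and moving [B n] by [g] costs 1/(n+1), whence 7. *)
have gQ g : G g -> g ** Q = Q.
  move=> Gg; apply: (eqP_lim _ _ _ 7) => n.
  have -> : g ** Q - Q = g ** (Q - B n) + (g ** B n - B n) - (Q - B n).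
    by rewrite bounded_op_compBr opprB !addrA !subrK.
  have -> : 7 * u n = 3 * u n + u n + 3 * u n by ring.
  apply: le_trans (ler_normB _ _) _; rewrite lerD//.
  apply: le_trans (ler_normD _ _) _; rewrite lerD//; last exact: Bl.
  apply: le_trans (bounded_op_comp_norm _ _) _.
  by apply: le_trans (QB n); rewrite ler_piMl// (group_norm_le1 hG).
have Qg g : G g -> Q ** g = Q.
  move=> Gg; apply: (eqP_lim _ _ _ 7) => n.
  have -> : Q ** g - Q = (Q - B n) ** g + (B n ** g - B n) - (Q - B n).
    by rewrite bounded_op_compBl opprB !addrA !subrK.
  have -> : 7 * u n = 3 * u n + u n + 3 * u n by ring.
  apply: le_trans (ler_normB _ _) _; rewrite lerD//.
  apply: le_trans (ler_normD _ _) _; rewrite lerD//; last exact: Br.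
  apply: le_trans (bounded_op_comp_norm _ _) _.
  by apply: le_trans (QB n); rewrite ler_piMr// (group_norm_le1 hG).
have fQ n (f : dual X) : `|adjoint Q f - adjoint (B n) f| <= `|f| * 3 * u n.
  rewrite -[X in `|X|](bounded_op_compBr f Q (B n)) -mulrA.
  apply: le_trans (bounded_op_comp_norm _ _) _.
  exact: ler_wpM2l.
exists Q; split=> //.
- by move=> x g Gg; rewrite -[in RHS](gQ g Gg).
- by move=> f x g Gg; rewrite -[in RHS](Qg g Gg).
- move=> f fG; apply: (eqP_lim _ _ _ (`|f| * 3)) => n.
  by have := fQ n f; rewrite (group_mean_invariant_functional (mB n) fG).
(* [F] is norm continuous on the dual, so the norm convergence of [adjoint (B n) f] to [adjoint Q f]
   is what passes to the limit. *)
- move=> F f FG; apply: (eqP_lim _ _ _ (`|F| * (`|f| * 3))) => n.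
  rewrite -(group_mean_invariant_bidual f (mB n) FG) -linearB.
  apply: le_trans (le_opnorm F _) _; rewrite -mulrA ler_wpM2l ?opnorm_ge0//.
Qed.

End projection.

(** * The topology sigma_G(X, X^* ) and G-reflexivity *)

Section weak_G_topology.
Context (R : realType) (k : scalar_kind) (X : normedModType (scalars R k)).
Local Notation K := (scalars R k).
Context (G : set (bounded_op X X)).
Local Notation wX := (weak_G_space G).

(** A neighbourhood of [p] contains a finite intersection of subbasic sets, each involving finitely
    many invariant functionals. *)
Lemma weak_G_cvg (U : set_system wX) (p : wX) : Filter U ->
  (forall (f : dual X) (e : K), invariant_functionals G f -> 0 < e ->
    U [set x : X | `|f p - f x| < e]) -> U --> p.
Proof.
move=> UF Up A; rewrite (@nbhsE wX) => -[_ [[B sB <-] [C BC Cp] BA]].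
rewrite nbhs_filterE; apply: filterS BA _; apply: (@filterS _ _ _ C).
  by move=> x Cx; exists C.
have [D sD DC] := sB _ BC; rewrite -DC in Cp *.
apply: filter_bigI => E DE; have := sD _ DE; rewrite inE.
move: (Cp _ DE) => Ep [x0 [n [f [e [fG e0 EE]]]]]; rewrite EE in Ep *.
apply: filter_forall => i.
(* The subbasic set is centred at x0; by the triangle inequality this smaller radius around [p]
   stays inside it. *)
have d0 : 0 < e - `|f i (p - x0)| by rewrite subr_gt0; exact: Ep.
apply: filterS (Up (f i) _ (fG i) d0) => x /= fx.
have -> : f i (x - x0) = f i (p - x0) - (f i p - f i x).
  have E3 (a b c : K) : a - b = c - b - (c - a) by ring.
  by rewrite (linearB (f i) x) (linearB (f i) p); exact: E3.
apply: le_lt_trans (ler_normB _ _) _.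
by rewrite -ltrBrDl.
Qed.

Lemma weak_G_nbhs (p : wX) (f : dual X) (e : K) :
  invariant_functionals G f -> 0 < e ->
  nbhs p [set x : X | `|f p - f x| < e].
Proof.
move=> fG e0; rewrite (@nbhsE wX).
pose V : set wX := [set x : X | forall i : 'I_1, `|f (x - p)| < e].
exists V; last by move=> x /= /(_ ord0); rewrite linearB distrC.
split; last by move=> i; rewrite subrr linear0 normr0.
exists [set V]; last by rewrite bigcup_set1.
move=> _ ->; exists (finmap.fset1 V); last by rewrite set_fset1 bigcap_set1.
move=> W; rewrite finmap.in_fset1 => /eqP WV; rewrite inE WV.
by exists p, 1%N, (fun=> f), e.
Qed.

End weak_G_topology.

(** * The two implications between reflexivity and compactness *)

Section reflexivity.
Context (R : realType) (k : scalar_kind).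
Context (X : completeNormedModType (scalars R k)).
Local Notation K := (scalars R k).
Context (G : set (bounded_op X X)).
Context (hG : compact_group_acting G).

(** [F] is the pointwise limit of the evaluations along [U]. Contractivity and linearity are
    checked, up to 1/(n+1), at one point of the ball approximating all the values involved. *)
Lemma ultra_bidual (U : set_system X) : UltraFilter U -> U (closed_unit_ball X) ->
  exists F : bidual X, (forall f, `|F f| <= `|f|) /\
    forall (f : dual X) (e : K), 0 < e -> U [set x | `|F f - f x| < e].
Proof.
move=> UU UB; have u0 n : 0 < n.+1%:R^-1 :> K by rewrite invr_gt0 ltr0n.
have /choice[F FU] (f : dual X) : exists l : K^o,
    forall e, 0 < e -> U [set x | `|l - f x| < e].
  apply: (@ultra_lim _ _ _ _ _ (to_real `|f|)) => //.
  apply: filterS UB => x /= x1; rewrite le_to_real//.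
  by apply: le_trans (le_opnorm f x) _; rewrite ler_piMr// opnorm_ge0.
have F1 f : `|F f| <= `|f|.
  apply: (@le_add_invn _ _ _ _ 1) => // n.
  have [x [/= Bx fx]] := filter_ex (filterI UB (FU f _ (u0 n))).
  rewrite mul1r -(subrK (f x) (F f)) addrC.
  apply: le_trans (ler_normD _ _) _; apply: lerD; last exact: ltW.
  by apply: le_trans (le_opnorm f x) _; rewrite ler_piMr// opnorm_ge0.
have FL : linear F.
  move=> a f g; apply/eqP; rewrite -subr_eq0 -normr_eq0; apply/eqP.
  apply: (@le_all_invn _ _ _ (1 + (`|a| + 1))) => // n.
  have [x [[/= h1 h2] h3]] := filter_ex (filterI (filterI
    (FU (a *: f + g) _ (u0 n)) (FU f _ (u0 n))) (FU g _ (u0 n))).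
  have -> : F (a *: f + g) - (a *: F f + F g) =
      (F (a *: f + g) - (a *: f + g) x) -
      (a *: (F f - f x) + (F g - g x)).
    rewrite scalerBr addrACA -opprD -[(a *: f + g) x]/(a *: f x + g x).
    by rewrite opprB addrA subrK.
  apply: le_trans (ler_normB _ _) _; rewrite mulrDl mul1r; apply: lerD.
    exact: ltW.
  apply: le_trans (ler_normD _ _) _; rewrite mulrDl mul1r; apply: lerD.
    by rewrite normrZ ler_wpM2l// ltW.
  exact: ltW.
have FC : continuous F.
  by apply: (bounded_linear_continuous_le (c := 1) FL) => f; rewrite mul1r.
by exists (mk_bounded_op FL FC).
Qed.

Lemma G_reflexive_compact : G_reflexive G ->
  @compact (weak_G_space G) (closed_unit_ball X).
Proof.
move=> Grefl; rewrite compact_ultra => U UU UB.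
have [P [P1 PG _ fP _]] := averaging_projection hG.
have [F [F1 FU]] := @ultra_bidual U UU UB.
(* Invariance comes from g P = P. *)
have : invariant_bidual G (adjoint (adjoint P) F).
  move=> g Gg; apply: bounded_opP => f; congr (F _).
  by apply: bounded_opP => x /=; rewrite (PG x g Gg).
rewrite -Grefl => -[x0 x0G x0F].
have fx0 (f : dual X) : f x0 = F (adjoint P f).
  by rewrite -[RHS]/(adjoint (adjoint P) F f) -x0F.
(* For a norming f, |f(x0)| = |F(f o P)| <= |f o P| <= 1 once [F], f and [P] are contractive up to
   the factor |x0|. *)
exists x0; split.
  have [f [f1 fn]] := norming_functional x0.
  rewrite /closed_unit_ball /= -le_to_real// -fn.
  apply: le_trans (to_real_le_norm _) _; rewrite le_to_real// fx0.
  apply: le_trans (F1 _) _; apply: opnorm_le => // x; rewrite mul1r.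
  by apply: le_trans (f1 _) _; exact: P1.
apply: weak_G_cvg => f e fG e0.
by rewrite fx0 (fP f fG); exact: FU.
Qed.

(** The sets of points of the ball approximating [F] on a finite list of invariant functionals form
    a filter base, nonempty by Helly's theorem; [x] is a cluster point of it. *)
Lemma compact_represents (F : bidual X) : (forall f, `|F f| <= `|f|) ->
  @compact (weak_G_space G) (closed_unit_ball X) ->
  exists x : X, forall f : dual X, invariant_functionals G f -> F f = f x.
Proof.
move=> F1 cB; have u0 n : 0 < n.+1%:R^-1 :> K by rewrite invr_gt0 ltr0n.
pose D := [set i : seq (dual X) * nat |
  forall f, f \in i.1 -> invariant_functionals G f].
pose S (i : seq (dual X) * nat) : set (weak_G_space G) := [set x : X | `|x| <= 1 /\
  forall f, f \in i.1 -> `|F f - f x| < i.2.+1%:R^-1].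
have FF : ProperFilter (filter_from D S).
  apply: filter_from_proper; last first.
    move=> [s n] _.
    (* A sum of squares below the square of 1/(n+1) makes each error less than 1/(n+1). *)
    have [|x x1 xs] := @helly _ _ _ F s (to_real (n.+1%:R^-1 : K) ^+ 2) F1.
      by rewrite exprn_gt0// -(of_realK k 0) of_real0 lt_to_real// ltW.
    exists x; split=> //= f fs; rewrite -lt_to_real ?(ltW (u0 n))//.
    rewrite -(@ltr_pXn2r _ 2) ?nnegrE ?to_real_norm_ge0//; last first.
      by rewrite -(of_real_ge0 k) to_realK ltW.
    apply: le_lt_trans xs; rewrite (big_rem f)//= lerDl.
    by apply: sumr_ge0 => g _; rewrite sqr_ge0.
  apply: filter_from_filter; first by exists ([::], 0).
  move=> [s n] [t m] /= sD tD; exists (s ++ t, maxn n m).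
    by move=> f; rewrite /= mem_cat => /orP[/sD|/tD].
  have uP i j : (i <= j)%N -> j.+1%:R^-1 <= i.+1%:R^-1 :> K.
    by move=> ij; rewrite lef_pV2 ?posrE ?ltr0n// ler_nat.
  move=> x [/= x1 xst]; split; split=> //= f fs.
    by apply: lt_le_trans (xst f _) (uP _ _ (leq_maxl _ _)); rewrite mem_cat fs.
  by apply: lt_le_trans (xst f _) (uP _ _ (leq_maxr _ _)); rewrite mem_cat fs orbT.
have [|p [_ pF]] := cB _ FF.
  by exists ([::], 0) => // x [].
exists p => f fG; apply/eqP; rewrite -subr_eq0 -normr_eq0; apply/eqP.
apply: (@le_all_invn _ _ _ 2) => // n.
have [|x [/= [x1 xf] fx]] := pF (S ([:: f], n)) _ _ (weak_G_nbhs p fG (u0 n)).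
  by exists ([:: f], n) => // g; rewrite inE => /eqP->.
have -> : F f - f p = (F f - f x) - (f p - f x) by rewrite opprB addrA subrK.
apply: le_trans (ler_normB _ _) _; rewrite mulrDl mul1r.
by apply: lerD; apply: ltW => //; apply: xf; rewrite inE.
Qed.

Lemma compact_G_reflexive :
  @compact (weak_G_space G) (closed_unit_ball X) -> G_reflexive G.
Proof.
move=> cB; apply/seteqP; split=> [_ [x xG <-] g Gg|F FG].
  by apply: bounded_opP => f; rewrite -[LHS]/(f (g x)) xG.
have [P [_ PG fPG _ FP]] := averaging_projection hG.
(* Rescales [F] to a contraction; adding 1 keeps [c] positive when F = 0. *)
pose c : K := opnorm F + 1.
have c0 : 0 < c by rewrite ltr_wpDl// opnorm_ge0.
have [f|x xF] := @compact_represents (c^-1 *: F) _ cB.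
  rewrite -[X in `|X|]/(c^-1 * F f) normrM normfV (gtr0_norm c0) ler_pdivrMl//.
  by apply: le_trans (le_opnorm F f) _; rewrite ler_wpM2r// lerDl.
(* For every f, the functional f o P is invariant, hence F f = F(f o P) = c f(P x). *)
exists (c *: P x); first by move=> g Gg; rewrite linearZ /= (PG x g Gg).
apply: bounded_opP => f.
have fPx : f (P x) = c^-1 * F (adjoint P f).
  by rewrite -[LHS]/(adjoint P f x) -(xF _ (fPG f)).
rewrite -(FP F f FG) -[RHS](mulVKf (lt0r_neq0 c0)) -fPx.
exact: linearZ.
Qed.

End reflexivity.

Theorem theorem11 (R : realType) (k : scalar_kind)
    (X : completeNormedModType (scalars R k)) (G : set (bounded_op X X))
    (hG : compact_group_acting G) :
  G_reflexive G <->
  @cover_compact (weak_G_space G) (closed_unit_ball X).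
Proof.
rewrite -compact_cover; split; first exact: G_reflexive_compact.
exact: compact_G_reflexive.
Qed.
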